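(* Let $K$ be a non-polar compact subset of $\mathbb C$, let $d\ge0$, and let $P(z)=a_dz^d+\dots+a_1z+a_0$ be a polynomial with complex coefficients, where $a_d$ may be zero. Then for every $k=0,\dots,d$, $$|a_k|\ \le\ \frac{\binom dk\,M(P)\,(\max_{z\in K}|z|)^{d-k}}{\mathrm{Cap}(K)^d}.$$
   Context: $\mu_K$ is the equilibrium measure of $K$ and $\mathrm{Cap}$ is logarithmic capacity. The Mahler measure of $P$ relative to $K$ is $M(P)=\exp[\int\log|P|\,d\mu_K]$, with $M(0)=0$. *)

(* Defs.v *)
(* The complex plane is modelled as R * R
   (with its product Borel sigma-algebra and product topology); complex
   numbers as R[i] from mathcomp-real-closed. *)
From mathcomp Require Import all_boot all_order all_algebra.
From mathcomp Require Import all_classical all_reals all_analysis.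
From mathcomp Require Import complex.
Set Implicit Arguments. Unset Strict Implicit. Unset Printing Implicit Defensive.
Import Order.TTheory GRing.Theory Num.Theory.
Local Open Scope classical_set_scope.
Local Open Scope ring_scope.

Section PotentialTheory.
Variable R : realType.

Definition cpt (p : R * R) : R[i] := Complex p.1 p.2.

Definition cabs (z : R[i]) : R :=
  let: Complex a b := z in Num.sqrt (a ^+ 2 + b ^+ 2).

Definition prob_on (K : set (R * R)) (mu : probability (R * R)%type R) : Prop :=
  mu K = 1%E.

Definition logkernel (pq : (R * R) * (R * R)) : \bar R :=
  let d := cabs (cpt pq.1 - cpt pq.2) in
  if d == 0 then +oo%E else (- ln d)%:E.

Definition log_energy (mu : probability (R * R)%type R) : \bar R :=
  (\int[mu \x mu]_pq logkernel pq)%E.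

Definition robin (K : set (R * R)) : \bar R :=
  ereal_inf [set log_energy mu | mu in [set mu | prob_on K mu]].

Definition log_cap (K : set (R * R)) : R :=
  match robin K with
  | r%:E => expR (- r)
  | +oo%E => 0
  | -oo%E => 0 (* does not happen for compact K *)
  end.

Definition non_polar (K : set (R * R)) : Prop := 0 < log_cap K.

Definition equilibrium_measure (K : set (R * R))
    (mu : probability (R * R)%type R) : Prop :=
  prob_on K mu /\ log_energy mu = robin K.

Definition logabs_poly (P : {poly R[i]}) (p : R * R) : \bar R :=
  let a := cabs P.[cpt p] in
  if a == 0 then -oo%E else (ln a)%:E.

Definition mahler (mu : probability (R * R)%type R) (P : {poly R[i]}) : R :=
  if P == 0 then 0 else
  match (\int[mu]_p logabs_poly P p)%E with
  | r%:E => expR r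
  | +oo%E => 0 (* does not happen: log|P| is bounded above on K *)
  | -oo%E => 0
  end.

(* max_{z in K} |z| (a supremum; attained since K is compact) *)
Definition maxmod (K : set (R * R)) : R := sup [set cabs (cpt z) | z in K].

End PotentialTheory.

(* Main.v *)
Require Import Defs.
From mathcomp Require Import all_boot all_order all_algebra.
From mathcomp Require Import all_classical all_reals all_analysis.
From mathcomp Require Import complex measurable_realfun.
From mathcomp Require Import ring lra.
Import Order.TTheory GRing.Theory Num.Theory numFieldNormedType.Exports.
Local Open Scope classical_set_scope.
Local Open Scope ring_scope.

(* Let V = - ln Cap(K), let p(w) be the integral of - ln |z - w| in z against mu,
   and r the maximum of |z| on K.  The heart of the matter is Frostman's theorem
   p <= V on the whole plane.  Minimality of the energy of mu among its
   reweightings mu + s mu|_B gives p <= V on a subset S of K of full measure.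
   For w' in S the bound p(w') <= V prevents mu from charging small discs around
   w', uniformly in w', so p <= V + o(1) at points close to S; away from S the
   function p + eps |w|^2 is strictly subharmonic, because the product of the
   distances from z to the four points w + i^j r is |(z - w)^4 - r^4|, so it has
   no maximum there; and p is very negative far away.  Reflecting w in the circle
   |w| = r improves p(w) <= V to exp(- p(w)) >= Cap(K) max(1, |w|/r).  Factoring
   P = a prod (z - z_j), M(P) = |a| prod exp(- p(z_j)), while the k-th coefficient
   of prod (z - z_j) is at most C(n,k) r^(n-k) prod max(1, |z_j|/r); finally
   Cap(K) <= r allows passing from n = deg P to d. *)

(** * Distances in the plane *)

Section PlaneDistance.
Context {R : realType}.
Implicit Types (x y z w : (R * R)%type) (u v : R[i]).

Lemma cabsE u : cabs u = Normc.normc u.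
Proof. by []. Qed.

Lemma cabs_ge0 u : 0 <= cabs u.
Proof. by case: u => a b; rewrite /cabs sqrtr_ge0. Qed.

Lemma cabs0 : cabs (0 : R[i]) = 0.
Proof. by rewrite cabsE Normc.normc0. Qed.

Lemma cabs1 : cabs (1 : R[i]) = 1.
Proof. by rewrite cabsE Normc.normc1. Qed.

Lemma cabs_eq0 u : (cabs u == 0) = (u == 0).
Proof.
apply/eqP/eqP => [|->]; last exact: cabs0.
by rewrite cabsE => /Normc.eq0_normc.
Qed.

Lemma cabsM u v : cabs (u * v) = cabs u * cabs v.
Proof. by rewrite !cabsE Normc.normcM. Qed.

Lemma cabsN u : cabs (- u) = cabs u.
Proof. by rewrite !cabsE; exact: normcN. Qed.

Lemma cabsD u v : cabs (u + v) <= cabs u + cabs v.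
Proof. by rewrite !cabsE; exact: le_normcD. Qed.

Lemma cabs_sqr u : cabs u ^+ 2 = complex.Re u ^+ 2 + complex.Im u ^+ 2.
Proof. by case: u => a b /=; rewrite sqr_sqrtr// addr_ge0 ?sqr_ge0. Qed.

Definition dst x y : R := cabs (cpt x - cpt y).

Lemma dst_ge0 x y : 0 <= dst x y.
Proof. exact: cabs_ge0. Qed.

Lemma dstC x y : dst x y = dst y x.
Proof. by rewrite /dst -cabsN opprB. Qed.

Lemma dst_triangle y x z : dst x z <= dst x y + dst y z.
Proof.
rewrite /dst; have -> : cpt x - cpt z = (cpt x - cpt y) + (cpt y - cpt z) by ring.
exact: cabsD.
Qed.

Lemma cpt_inj : injective (@cpt R).
Proof. by move=> [a b] [c d] [/= -> ->]. Qed.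

Lemma cpt0 : cpt (0, 0) = 0 :> R[i].
Proof. by []. Qed.

Lemma dst_eq0 x y : (dst x y == 0) = (x == y).
Proof.
rewrite /dst cabs_eq0 subr_eq0; apply/eqP/eqP => [|-> //]; exact: cpt_inj.
Qed.

Lemma dstxx x : dst x x = 0.
Proof. by apply/eqP; rewrite dst_eq0. Qed.

Lemma dst0 x : dst x (0, 0) = cabs (cpt x).
Proof. by rewrite /dst cpt0 subr0. Qed.

Lemma dst_sqr x y : dst x y ^+ 2 = (x.1 - y.1) ^+ 2 + (x.2 - y.2) ^+ 2.
Proof. by rewrite cabs_sqr. Qed.

(** Balls of the product topology are squares, so the Euclidean distance may exceed the radius; the
    factor 2 is a crude substitute for the square root of 2. *)
Lemma ball_dst_lt x y (e : R) : 0 < e -> ball x e y -> dst x y < 2 * e.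
Proof.
move=> e0 [/= b1 b2].
have le2 (a : R) : `|a| < e -> a ^+ 2 < e ^+ 2.
  by move=> ae; rewrite -real_normK ?num_real// ltr_pXn2r ?nnegrE// ltW.
rewrite -(@ltr_pXn2r _ 2) ?nnegrE ?dst_ge0//; last by rewrite mulr_ge0// ltW.
rewrite dst_sqr; move: (le2 _ b1) (le2 _ b2) (sqr_ge0 e).
by rewrite exprMn; lra.
Qed.

Lemma measurable_dst :
  measurable_fun setT (fun p : (R * R) * (R * R) => dst p.1 p.2).
Proof.
rewrite (_ : (fun _ => _) = fun p : (R * R) * (R * R) =>
  Num.sqrt ((p.1.1 - p.2.1) ^+ 2 + (p.1.2 - p.2.2) ^+ 2)); last first.
  by apply/funext => p; rewrite -dst_sqr sqrtr_sqr ger0_norm ?dst_ge0.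
apply: measurableT_comp.
  by apply: continuous_measurable_fun; exact: sqrt_continuous.
by apply: measurable_funD; apply: measurable_funX; apply: measurable_funB;
  do ?[apply: measurableT_comp => //].
Qed.

(** Measurability refers to the product sigma-algebra, so [U] is written as a countable union of
    squares with rational centres and radii 1/(n+1). *)
Lemma open_measurable_plane (U : set (R * R)) : open U -> measurable U.
Proof.
move=> oU; pose I := (rat * rat * nat)%type.
pose B (i : I) : set (R * R) :=
  ball (ratr i.1.1 : R) (i.2.+1%:R^-1) `*` ball (ratr i.1.2 : R) (i.2.+1%:R^-1).
(* Squares that leave [U] become empty, so that the union can run over the whole countable type
   [I]. *)
pose F (i : I) := if `[< B i `<=` U >] then B i else set0.
rewrite (_ : U = \bigcup_i F i).
  apply: countable_bigcupT_measurable; first exact: countableP.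
  move=> i; rewrite /F; case: ifP => _; last exact: measurable0.
  by apply: measurableX; exact: measurable_ball.
apply/seteqP; split => [x Ux|x [i _]]; last first.
  by rewrite /F; case: ifPn => [/asboolP BU /BU|].
have /nbhs_ballP[e /= e0 xeU] : nbhs x U by exact: open_nbhs_nbhs.
have [n ne] : exists n, n.+1%:R^-1 < e / 2.
  have e20 : 0 < e / 2 by rewrite divr_gt0.
  have [n _ nP] := near_infty_natSinv_lt (PosNum e20).
  by exists n; exact: (nP n (leqnn n)).
have n0 : (0 : R) < n.+1%:R^-1 by rewrite invr_gt0.
have near_rat (r a : R) : 0 < r -> exists q : rat, ball (ratr q : R) r a.
  move=> r0; have lt_a : a - r < a + r by lra.
  have [q] := rat_in_itvoo lt_a.
  rewrite in_itv/= => /andP[q1 q2]; exists q.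
  by rewrite /ball/= ltr_norml; apply/andP; split; lra.
have [q1 hq1] := near_rat _ x.1 n0; have [q2 hq2] := near_rat _ x.2 n0.
exists (q1, q2, n) => //; rewrite /F; case: ifPn => [_|/asboolPn]; first by split.
case=> y [/= y1 y2]; apply: xeU.
move: (n.+1%:R^-1) ne hq1 hq2 y1 y2 => r re hq1 hq2 y1 y2.
by split; rewrite /= /ball/=; [move: hq1 y1|move: hq2 y2]; rewrite /ball/=
  !ltr_norml => /andP[? ?] /andP[? ?]; apply/andP; split; lra.
Qed.

Lemma compact_measurable_plane (K : set (R * R)) : compact K -> measurable K.
Proof.
move=> cptK; have cK : closed K by apply: compact_closed => //; exact: norm_hausdorff.
rewrite -(setCK K); apply: measurableC; apply: open_measurable_plane.
exact: closed_openC.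
Qed.

Lemma compact_bounded_plane (K : set (R * R)) : compact K ->
  exists2 M : R, 0 < M & forall x, K x -> cabs (cpt x) <= M.
Proof.
move=> /compact_bounded[M [_ MK]].
exists (2 * (`|M| + 2)); first by rewrite mulr_gt0// ltr_wpDl.
have M1 : M < `|M| + 1 by rewrite (le_lt_trans (ler_norm M))// ltrDl.
move=> x /(MK (`|M| + 1) M1) xM; rewrite -dst0.
apply/ltW/ball_dst_lt; first by rewrite ltr_wpDl.
by rewrite -ball_normE /= subr0 (le_lt_trans xM)// ltrD2l ltr1n.
Qed.

End PlaneDistance.

(** * Reweighted probability measures *)

Section MeasureComplements.
Context {d : measure_display} {T : measurableType d} {R : realType}.
Local Open Scope ereal_scope.

Lemma ge0_integral_full (m : {measure set T -> \bar R}) (A : set T)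
    (f : T -> \bar R) :
  measurable A -> m (~` A) = 0 -> measurable_fun setT f -> (forall x, 0 <= f x) ->
  \int[m]_x f x = \int[m]_(x in A) f x.
Proof.
move=> mA mA0 mf f0.
rewrite (@ge0_negligible_integral _ _ _ m setT (~` A) f)//; last exact: measurableC.
by rewrite setTD setCK.
Qed.

(** The integral of [f] may be +oo, so additivity is not automatic. On [A] the negative part of [f]
    is at most [c], hence has a finite integral, which can be moved across. *)
Lemma integral_shift (m : {measure set T -> \bar R}) (A : set T)
    (f : T -> \bar R) (c : R) :
  measurable A -> m A = 1 -> m (~` A) = 0 -> measurable_fun setT f ->
  (0 <= c)%R -> (forall x, A x -> 0 <= f x + c%:E) ->
  \int[m]_(x in A) (f x + c%:E) = \int[m]_x f x + c%:E.
Proof.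
move=> mA mA1 mA0 mf c0 fc.
have mfA : measurable_fun A f by exact: measurable_funTS.
have fn_c x : A x -> f^\- x <= c%:E.
  move=> /fc; rewrite funenegE ge_max lee_fin c0 andbT.
  by case: (f x) => [r| |]; [rewrite -EFinD !lee_fin; lra|rewrite leNye|].
have intc : \int[m]_(x in A) (cst c%:E x) = c%:E.
  by rewrite integral_cst// mA1 mule1.
have split_f : \int[m]_(x in A) (f x + c%:E) + \int[m]_(x in A) f^\- x =
    \int[m]_(x in A) f^\+ x + c%:E.
  rewrite -[in RHS]intc -!ge0_integralD//.
  - apply: eq_integral => x /set_mem Ax.
    rewrite /= funeposE funenegE; have := fc _ Ax; case: (f x) => [r| |] //=.
    + move=> _; rewrite -!EFin_max -!EFinD; congr (_%:E).
      by case: (leP r 0%R); case: (leP (- r)%R 0%R); lra.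
    + by move=> _; rewrite max_r// addye.
  - by apply: measurable_funTS; exact: measurable_funepos.
  - by apply: emeasurable_funD => //.
  - by apply: measurable_funTS; exact: measurable_funeneg.
have fin_n : \int[m]_(x in A) f^\- x \is a fin_num.
  rewrite ge0_fin_numE ?integral_ge0//.
  rewrite (@le_lt_trans _ _ c%:E) ?ltry// -[leRHS]intc; apply: ge0_le_integral => //.
  by apply: measurable_funTS; exact: measurable_funeneg.
rewrite (integralE m setT f) (@ge0_integral_full _ A f^\+)//; last exact: measurable_funepos.
rewrite (@ge0_integral_full _ A f^\-)//; last exact: measurable_funeneg.
rewrite addeAC -split_f addeK//.
Qed.

Lemma ge0_integral_mrestr (mu : {measure set T -> \bar R}) (B : set T)
    (mB : measurable B) (f : T -> \bar R) :
  measurable_fun setT f -> (forall x, 0 <= f x) ->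
  \int[mrestr mu mB]_x f x = \int[mu]_(x in B) f x.
Proof.
move=> mf f0; rewrite (@ge0_integral_full (mrestr mu mB) B)//; last first.
  by rewrite -[LHS]/(mu (~` B `&` B)) setICl measure0.
apply: eq_measure_integral => A mA AB.
by rewrite -[LHS]/(mu (A `&` B)) setIidl.
Qed.

Lemma mnormalizeE (m : {measure set T -> \bar R}) (P : probability T R)
    (A : set T) (r : R) :
  m setT = r%:E -> (0 < r)%R -> mnormalize m P A = m A * (r^-1)%:E.
Proof.
by move=> mr r0; rewrite /mnormalize mr orbF ifN// eqe gt_eqF.
Qed.

Variable mu : probability T R.

(** The competitors in the energy problem. The fallback [mu] of [mnormalize] is never reached,
    because the total mass 1 + s mu(B) is finite and positive. *)
Definition reweight (s : {nonneg R}) {B : set T} (mB : measurable B) :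
  probability T R := mnormalize (measure_add mu (mscale s (mrestr mu mB))) mu.

Lemma reweightE (s : {nonneg R}) (B : set T) (mB : measurable B) (A : set T) :
  reweight s mB A = (mu A + s%:num%:E * mu (A `&` B)) *
    ((1 + s%:num * fine (mu B))^-1)%:E.
Proof.
have Bfin : mu B \is a fin_num by exact: fin_num_measure.
pose m : {measure set T -> \bar R} := measure_add mu (mscale s (mrestr mu mB)).
apply: (etrans (@mnormalizeE m mu A (1 + s%:num * fine (mu B))%R _ _)).
- apply: (etrans (measure_addE _ _ _)); rewrite EFinD EFinM fineK// -[in RHS](setTI B).
  by congr (_ + _); exact: probability_setT.
- by rewrite ltr_pwDl// mulr_ge0// fine_ge0.
- by congr (_ * _); exact: measure_addE.
Qed.

Lemma reweight_integral (s : {nonneg R}) (B : set T) (mB : measurable B)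
    (f : T -> \bar R) :
  measurable_fun setT f -> (forall x, 0 <= f x) ->
  \int[reweight s mB]_x f x = ((1 + s%:num * fine (mu B))^-1)%:E *
    (\int[mu]_x f x + s%:num%:E * \int[mu]_(x in B) f x).
Proof.
move=> mf f0.
have k0 : (0 <= (1 + s%:num * fine (mu B))^-1)%R.
  by rewrite invr_ge0 addr_ge0// mulr_ge0// fine_ge0.
rewrite (@eq_measure_integral _ _ _ _
  (mscale (NngNum k0) (measure_add mu (mscale s (mrestr mu mB))))); last first.
  move=> A mA _; apply: (etrans (reweightE s B mB A)); rewrite muleC.
  by congr (_ * _); exact/esym/measure_addE.
rewrite ge0_integral_mscale// ge0_integral_measure_add// ge0_integral_mscale//.
by rewrite ge0_integral_mrestr.
Qed.

End MeasureComplements.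

(** * First variation of the energy *)

Section EnergyVariation.
Context {d : measure_display} {T : measurableType d} {R : realType}.
Local Open Scope ereal_scope.
Variables (mu : probability T R) (g : T * T -> \bar R) (E : R).
Hypotheses (mg : measurable_fun setT g) (g0 : forall p, 0 <= g p).
Hypothesis gC : forall x y, g (x, y) = g (y, x).

Definition potential (nu : {measure set T -> \bar R}) (x : T) : \bar R :=
  \int[nu]_y g (x, y).

Let mgx x : measurable_fun setT (fun y => g (x, y)).
Proof. exact: measurableT_comp. Qed.

Lemma potential_ge0 (nu : {measure set T -> \bar R}) x : 0 <= potential nu x.
Proof. exact: integral_ge0. Qed.

Lemma measurable_potential (nu : probability T R) :
  measurable_fun setT (potential nu).
Proof. exact: (measurable_fun_fubini_tonelli_F g). Qed.

Hypothesis energy_mu : \int[mu]_x potential mu x = E%:E.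
Hypothesis energy_min : forall (B : set T) (mB : measurable B) (s : {nonneg R}),
  E%:E <= \int[reweight mu s mB]_x potential (reweight mu s mB) x.

Let potB (B : set T) (x : T) := \int[mu]_(y in B) g (x, y).

Let potBE (B : set T) (mB : measurable B) x :
  potB B x = \int[mu]_y (g (x, y) * (\1_B y)%:E).
Proof. by rewrite /potB integral_mkcond; apply: eq_integral => y _; rewrite epatch_indic. Qed.

Let gB (B : set T) (p : T * T) := g p * (\1_B p.2)%:E.

Let gB0 B p : 0 <= gB B p.
Proof. by rewrite mule_ge0// lee_fin. Qed.

Let mgB (B : set T) : measurable B -> measurable_fun setT (gB B).
Proof.
move=> mB; apply: emeasurable_funM => //; apply/measurable_EFinP.
by apply: measurableT_comp => //; exact: measurable_indic.
Qed.

Let mpotB (B : set T) : measurable B -> measurable_fun setT (potB B).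
Proof.
move=> mB; apply: (eq_measurable_fun (fubini_F mu (gB B))).
  by move=> x _; rewrite potBE.
by apply: measurable_fun_fubini_tonelli_F => //; exact: mgB.
Qed.

Let potB_ge0 B x : 0 <= potB B x.
Proof. exact: integral_ge0. Qed.

(** Tonelli and the symmetry of [g]: the two cross terms in the energy of a reweighting coincide. *)
Let int_potB (B : set T) : measurable B ->
  \int[mu]_x potB B x = \int[mu]_(x in B) potential mu x.
Proof.
move=> mB; under eq_integral do rewrite potBE//.
rewrite (fubini_tonelli (gB B))//; last exact: mgB.
rewrite [RHS]integral_mkcond; apply: eq_integral => y _.
rewrite epatch_indic /potential -ge0_integralZr//; last by rewrite lee_fin.
by apply: eq_integral => x _; rewrite /gB/= gC.
Qed.

(** Before normalisation the energy of mu + s mu|_B is E + 2sX + s^2 Y, and minimality bounds it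
    below by E(1 + sb)^2 with b = mu(B). Comparing the terms linear in s gives Eb <= X. *)
Lemma energy_variation (B : set T) : measurable B ->
  (E * fine (mu B))%:E <= \int[mu]_(x in B) potential mu x.
Proof.
move=> mB; set X := \int[mu]_(x in B) potential mu x.
have mp := measurable_potential mu.
have XE : X <= E%:E.
  rewrite -energy_mu; apply: ge0_subset_integral => // x _.
  exact: potential_ge0.
have X0 : 0 <= X by apply: integral_ge0 => x _; exact: potential_ge0.
have E0 : (0 <= E)%R by rewrite -lee_fin (le_trans X0).
have Xfin : X \is a fin_num by rewrite ge0_fin_numE// (le_lt_trans XE)// ltry.
set Y := \int[mu]_(x in B) potB B x.
have YE : Y <= E%:E.
  rewrite (le_trans _ XE)//; apply: ge0_le_integral => //.
  - by apply: measurable_funTS; exact: mpotB.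
  - exact: measurable_funTS.
  by move=> x _; apply: ge0_subset_integral.
have Y0 : 0 <= Y by exact: integral_ge0.
have Yfin : Y \is a fin_num by rewrite ge0_fin_numE// (le_lt_trans YE)// ltry.
set b := fine (mu B).
have b0 : (0 <= b)%R by exact: fine_ge0.
have quad (s : {nonneg R}) : (E * (1 + s%:num * b) ^+ 2 <=
    E + s%:num * fine X + s%:num * (fine X + s%:num * fine Y))%R.
  have := energy_min _ mB s.
  set k := ((1 + s%:num * b)^-1)%R.
  have k0 : (0 < k)%R by rewrite invr_gt0 ltr_pwDl// mulr_ge0.
  have potE x : potential (reweight mu s mB) x =
      k%:E * (potential mu x + s%:num%:E * potB B x).
    by rewrite /potential reweight_integral.
  have sB0 x : 0 <= s%:num%:E * potB B x by rewrite mule_ge0// lee_fin.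
  have msB : measurable_fun setT (fun x => s%:num%:E * potB B x).
    by apply: measurable_funeM; exact: mpotB.
  have in0 x : 0 <= potential mu x + s%:num%:E * potB B x.
    by rewrite adde_ge0// potential_ge0.
  have min : measurable_fun setT (fun x => potential mu x + s%:num%:E * potB B x).
    exact: emeasurable_funD.
  under eq_integral do rewrite potE.
  have mpB := mpotB _ mB.
  rewrite reweight_integral; last 2 first.
  - exact: measurable_funeM.
  - by move=> x; rewrite mule_ge0// lee_fin ltW.
  have k0' : 0 <= k%:E by rewrite lee_fin ltW.
  rewrite !ge0_integralZl//; try exact: measurable_funTS.
  have gp0 x : 0 <= potential mu x by exact: potential_ge0.
  have intD D : measurable D ->
      \int[mu]_(x in D) (potential mu x + s%:num%:E * potB B x) =
      \int[mu]_(x in D) potential mu x + s%:num%:E * \int[mu]_(x in D) potB B x.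
    move=> mD; rewrite -ge0_integralZl//; last exact: measurable_funTS.
    by apply: ge0_integralD => //; exact: measurable_funTS.
  rewrite !intD//.  
  rewrite int_potB// energy_mu -/X -/Y -(fineK Xfin) -(fineK Yfin).
  rewrite -?(EFinM, EFinD) lee_fin => /(ler_wpM2r (sqr_ge0 (1 + s%:num * b))).
  have kk : (k * (1 + s%:num * b) = 1)%R by rewrite mulVf// gt_eqF// -invr_gt0.
  move=> /le_trans; apply; rewrite -/b -/k.
  have -> : (forall u v w : R, k * (k * u + v * (k * w)) * (1 + s%:num * b) ^+ 2 =
      (k * (1 + s%:num * b)) ^+ 2 * (u + v * w))%R by move=> u v w; ring.
  by rewrite kk expr1n mul1r.
rewrite -(fineK Xfin) lee_fin leNgt; apply/negP => XbE.
(* Since Y <= E, [quad] would give 2(Eb - X) <= sE for s > 0. This s makes sE smaller than Eb - X, a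
   contradiction. *)
have s0 : (0 <= (E * b - fine X) / (E + 1))%R.
  by apply: divr_ge0; [rewrite subr_ge0 ltW|rewrite addr_ge0].
have := quad (NngNum s0); rewrite /=; set s := (_ / _)%R.
have sE : (s * (E + 1) = E * b - fine X)%R by rewrite /s mulfVK// gt_eqF// ltr_wpDl.
have spos : (0 < s)%R by rewrite divr_gt0 ?subr_gt0// ltr_wpDl.
have YE' : (fine Y <= E)%R by rewrite -lee_fin fineK.
have h1 : (s * (s * fine Y) <= s * (s * E))%R by rewrite !ler_pM2l.
have h2 : (0 <= E * (s * b) ^+ 2)%R by rewrite mulr_ge0// sqr_ge0.
rewrite leNgt => /negP; apply.
have h3 : (s * (fine X) = s * (E * b) - s * (s * (E + 1)))%R by rewrite sE; ring.
have h4 : (0 < s * s)%R by rewrite mulr_gt0.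
have h5 : (0 <= s * s * E)%R by rewrite mulr_ge0// mulr_ge0// ltW.
have h6 : (E * (1 + s * b) ^+ 2 = E + 2 * (s * (E * b)) + E * (s * b) ^+ 2)%R by ring.
have h7 : (s * (s * (E + 1)) = s * s * E + s * s)%R by ring.
have h8 : (s * (s * E) = s * s * E)%R by ring.
rewrite h6 mulrDr.
by lra.
Qed.

(** The variation gives lower bounds, so it is applied to the complement of [C]. As the total energy
    is E, the integral over [C] is then at most E mu(C), although the integrand exceeds E there. *)
Lemma potential_le_ae : mu [set x | E%:E < potential mu x] = 0.
Proof.
have mp := measurable_potential mu.
have p0 x : 0 <= potential mu x := potential_ge0 mu x.
set C := [set x | E%:E < potential mu x].
have mC : measurable C by rewrite -[C]setTI; apply: emeasurable_fun_o_infty.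
have E0 : (0 <= E)%R by rewrite -lee_fin -energy_mu integral_ge0.
have Cfin : mu C \is a fin_num by exact: fin_num_measure.
have Bfin : mu (~` C) \is a fin_num.
  by apply: fin_num_measure; exact: measurableC.
have mu1 : (fine (mu C) + fine (mu (~` C)) = 1)%R.
  apply: EFin_inj; rewrite EFinD !fineK// -measureU ?setIUr ?setICr ?setUCr//.
  + exact: probability_setT.
  + exact: measurableC.
have splitE : \int[mu]_(x in C) potential mu x +
    \int[mu]_(x in ~` C) potential mu x = E%:E.
  rewrite -ge0_integral_setU ?setUCr ?energy_mu//; first exact: measurableC.
  by apply/disj_setPCl.
have intC : \int[mu]_(x in C) potential mu x <= \int[mu]_(x in C) E%:E.
  have lb := energy_variation _ (measurableC mC).
  have -> : \int[mu]_(x in C) E%:E = (E * fine (mu C))%:E.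
    by rewrite EFinM fineK// integral_cst.
  have -> : (E * fine (mu C) = E - E * fine (mu (~` C)))%R.
    by rewrite -[X in (X - _)%R]mulr1 -mu1; ring.
  rewrite EFinB leeBrDr// -splitE leeD2l//.
set f := fun x => potential mu x - E%:E.
have f0 x : C x -> 0 <= f x by rewrite /C/= /f => /ltW; rewrite sube_ge0.
have mf : measurable_fun C f.
  by apply: emeasurable_funB => //; exact: measurable_funTS.
have intf : \int[mu]_(x in C) `|f x| = 0.
  apply/eqP; rewrite eq_le integral_ge0// andbT.
  rewrite -(@leeD2lE _ (\int[mu]_(x in C) E%:E)); last first.
    by rewrite integral_cst// fin_numM.
  rewrite adde0 (le_trans _ intC)// -ge0_integralD//; last first.
    exact: measurableT_comp.
  apply: ge0_le_integral => //.
  - by move=> x Cx; rewrite adde_ge0.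
  - by apply: emeasurable_funD => //; exact: measurableT_comp.
  - exact: measurable_funTS.
  - by move=> x Cx; rewrite gee0_abs ?f0// /f addeC subeK.
have /(ae_eq_integral_abs mu mC mf)[N [mN N0 CN]] := intf.
apply: (subset_measure0 mC mN _ N0) => x Cx; apply: CN => /= /(_ Cx).
by apply/eqP; rewrite /f gt_eqF// sube_gt0.
Qed.

End EnergyVariation.

(** * The logarithmic kernel *)

Section LogKernel.
Context {R : realType}.
Implicit Types (x y z w : (R * R)%type) (c : R).
Local Open Scope ereal_scope.

Lemma logkernelE x y :
  logkernel (x, y) = if dst x y == 0%R then +oo else (- ln (dst x y))%:E.
Proof. by []. Qed.

Lemma logkernel_neq x y : x != y -> logkernel (x, y) = (- ln (dst x y))%:E.
Proof. by rewrite logkernelE dst_eq0 => /negbTE ->. Qed.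

Lemma logkernelxx x : logkernel (x, x) = +oo :> \bar R.
Proof. by rewrite logkernelE dstxx eqxx. Qed.

Lemma logkernelC x y : logkernel (x, y) = logkernel (y, x) :> \bar R.
Proof. by rewrite !logkernelE dstC. Qed.

Lemma measurable_logkernel : measurable_fun setT (@logkernel R).
Proof.
have md := @measurable_dst R.
apply: measurable_fun_ifT.
- exact: measurable_fun_eqr.
- exact: measurable_cst.
- apply/measurable_EFinP/measurable_funN.
  by apply: (measurableT_comp (@measurable_ln R)).
Qed.

Lemma measurable_logkernel_sec x : measurable_fun setT (fun y => logkernel (x, y) : \bar R).
Proof. by apply: (measurableT_comp measurable_logkernel). Qed.

(* Logarithmic kernel for the unit of length [expR c]: nonnegative for points at
   distance at most [expR c]. *)
Definition skernel c x y : \bar R := logkernel (x, y) + c%:E.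

Lemma skernel_neq c x y : x != y -> skernel c x y = (c - ln (dst x y))%:E.
Proof. by move=> xy; rewrite /skernel logkernel_neq// -EFinD addrC. Qed.

Lemma skernelxx c x : skernel c x x = +oo.
Proof. by rewrite /skernel logkernelxx. Qed.

Lemma skernel_ge0 c x y : (dst x y <= expR c)%R -> 0 <= skernel c x y.
Proof.
have [<- _|xy dxy] := eqVneq x y; first by rewrite skernelxx.
have d0 : (0 < dst x y)%R by rewrite lt_neqAle dst_ge0 eq_sym dst_eq0 xy.
by rewrite skernel_neq// lee_fin subr_ge0 -[leRHS](expRK c) ler_ln ?posrE ?expR_gt0.
Qed.

Lemma measurable_skernel c x (A : set (R * R)) : measurable_fun A (skernel c x).
Proof.
apply: measurable_funTS; apply: emeasurable_funD; first exact: measurable_logkernel_sec.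
exact: measurable_cst.
Qed.

Lemma probability_compl {d} {T : measurableType d} (m : probability T R) (A : set T) :
  measurable A -> m A = 1 -> m (~` A) = 0.
Proof. by move=> mA mA1; rewrite probability_setC// mA1 subee. Qed.

Lemma product_full {d} {T : measurableType d} (m : probability T R) (A : set T) :
  measurable A -> m A = 1 ->
  (m \x m) (A `*` A) = 1 /\ (m \x m) (~` (A `*` A)) = 0.
Proof.
move=> mA mA1; have mAA : measurable (A `*` A) by exact: measurableX.
have AA1 : (m \x m) (A `*` A) = 1.
  by transitivity (m A * m A); [exact: product_measure1E|rewrite mA1 mule1].
have TT1 : (m \x m) setT = 1.
  transitivity (m setT * m setT); last by rewrite probability_setT mule1.
  by rewrite -setXTT; exact: product_measure1E.
split => //; rewrite -setTD measureD ?setTI//; last first.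
  by rewrite [ltLHS](_ : _ = 1) ?ltry//; exact: TT1.
transitivity (1 - 1 : \bar R); last by rewrite subee.
by congr (_ - _); [exact: TT1|exact: AA1].
Qed.

(** * Frostman's inequality almost everywhere *)

Section Equilibrium.
Variables (K : set (R * R)) (c : R).
Hypotheses (mK : measurable K) (c0 : (0 <= c)%R).
Hypothesis Kc : forall x y, K x -> K y -> (dst x y <= expR c)%R.

(** Extension by 0 off [K] x [K] makes the shifted kernel nonnegative everywhere, as the first
    variation requires; measures carried by [K] do not see the change. *)
Let g : (R * R) * (R * R) -> \bar R := (fun p => logkernel p + c%:E) \_ (K `*` K).

Let mg : measurable_fun setT g.
Proof.
apply/(measurable_restrictT _ (measurableX mK mK)).
apply: measurable_funTS; apply: emeasurable_funD; first exact: measurable_logkernel.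
exact: measurable_cst.
Qed.

Let g0 p : 0 <= g p.
Proof.
rewrite /g patchE; case: ifPn => // /set_mem [K1 K2].
by case: p K1 K2 => x y /= Kx Ky; exact: skernel_ge0 (Kc _ _ Kx Ky).
Qed.

Let gC x y : g (x, y) = g (y, x).
Proof. by rewrite /g !patchE !in_setX/= andbC logkernelC. Qed.

Let energyE (nu : probability (R * R)%type R) : prob_on K nu ->
  \int[nu]_x potential g nu x = log_energy nu + c%:E.
Proof.
move=> nuK; have [KK1 KK0] := product_full _ _ mK nuK.
rewrite -(integral_shift _ _ _ _ (measurableX mK mK) KK1 KK0 measurable_logkernel c0).
  by rewrite integral_mkcond -/g fubini_tonelli1.
by move=> [x y] [/= Kx Ky]; exact: skernel_ge0 (Kc _ _ Kx Ky).
Qed.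

(** Reweightings of [mu] stay carried by [K], hence compete with [mu], and passing to [g] adds c to
    every energy. The first variation then applies, and [S] is [K] without a null set. *)
Lemma equilibrium_potential_le (mu : probability (R * R)%type R) (V : R) :
  prob_on K mu -> log_energy mu = V%:E ->
  (forall nu, prob_on K nu -> V%:E <= log_energy nu) ->
  let S := K `&` [set x | \int[mu]_(y in K) skernel c x y <= (V + c)%:E] in
  measurable S /\ mu S = 1.
Proof.
move=> muK muV Vmin S.
have e_mu : \int[mu]_x potential g mu x = (V + c)%:E by rewrite energyE// muV.
have e_min (B : set (R * R)) (mB : measurable B) (s : {nonneg R}) :
    (V + c)%:E <= \int[reweight mu s mB]_x potential g (reweight mu s mB) x.
  have nuK : prob_on K (reweight mu s mB).
    have KC0 : reweight mu s mB (~` K) = 0.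
      apply: (etrans (reweightE _ _ _ mB (~` K))).
      rewrite (probability_compl _ _ mK muK) add0e.
      rewrite (@subset_measure0 _ _ _ mu (~` K `&` B) (~` K)) ?mule0 ?mul0e//.
      - by apply: measurableI => //; exact: measurableC.
      - exact: measurableC.
      - exact: probability_compl.
    rewrite /prob_on -(setCK K) probability_setC ?KC0 ?sube0//.
    exact: measurableC.
  by rewrite energyE// EFinD leeD2r// Vmin.
have := potential_le_ae mu g _ mg g0 gC e_mu e_min.
set N := [set x | _] => N0.
have mN : measurable N.
  rewrite -[N]setTI; apply: emeasurable_fun_o_infty => //.
  exact: (measurable_potential g mg g0 mu).
have potE x : K x -> \int[mu]_(y in K) skernel c x y = potential g mu x.
  move=> Kx; rewrite integral_mkcond; apply: eq_integral => y _.
  by rewrite /g !patchE in_setX/= (mem_set Kx).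
have SE : S = K `\` N.
  apply/seteqP; split => [x [Kx /=]|x [Kx /= /negP]].
    by rewrite potE// leNgt => /negP.
  by rewrite -leNgt => pV; split => //=; rewrite potE.
have mS : measurable S by rewrite SE; exact: measurableD.
split => //; rewrite SE measureD//; last first.
  by rewrite [ltLHS](_ : _ = 1) ?ltry//; exact: muK.
transitivity (1 - 0 : \bar R); last by rewrite sube0.
congr (_ - _); first exact: muK.
by apply: (subset_measure0 _ mN _ N0); first exact: measurableI.
Qed.

End Equilibrium.

End LogKernel.

(** * The maximum principle for logarithmic potentials *)

Section FourPoints.
Context {R : realType}.
Implicit Types (u w z : (R * R)%type) (a : R[i]) (r : R).

Lemma cabs_real r : 0 <= r -> cabs (Complex r 0) = r.
Proof. by move=> r0; rewrite /cabs expr0n addr0 sqrtr_sqr ger0_norm. Qed.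

Lemma cabs_exp a n : cabs (a ^+ n) = cabs a ^+ n.
Proof. by elim: n => [|n IH]; rewrite ?expr0 ?cabs1// !exprS cabsM IH. Qed.

Definition shiftE u r : R * R := (u.1 + r, u.2).
Definition shiftN u r : R * R := (u.1, u.2 + r).

(* The four shifts of [u] by [r] times the fourth roots of unity: the product
   of the distances to [z] is |(u - z)^4 - r^4|. *)
Lemma four_point_prod u z r : 0 <= r ->
  dst (shiftE u r) z * dst (shiftE u (- r)) z *
  (dst (shiftN u r) z * dst (shiftN u (- r)) z) <= dst u z ^+ 4 + r ^+ 4.
Proof.
move=> r0; rewrite /dst -!cabsM -cabs_exp.
have -> : (cpt (shiftE u r) - cpt z) * (cpt (shiftE u (- r)) - cpt z) *
    ((cpt (shiftN u r) - cpt z) * (cpt (shiftN u (- r)) - cpt z)) =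
    (cpt u - cpt z) ^+ 4 - Complex r 0 ^+ 4.
  pose a : R[i] := cpt u - cpt z; pose q : R[i] := Complex r 0.
  pose I : R[i] := Complex 0 1.
  have II : I * I = - 1 by apply/eqP; rewrite eq_complex /=; apply/andP; split; apply/eqP; ring.
  have E1 : cpt (shiftE u r) - cpt z = a + q.
    by apply/eqP; rewrite eq_complex /=; apply/andP; split; apply/eqP; ring.
  have E2 : cpt (shiftE u (- r)) - cpt z = a - q.
    by apply/eqP; rewrite eq_complex /=; apply/andP; split; apply/eqP; ring.
  have E3 : cpt (shiftN u r) - cpt z = a + I * q.
    by apply/eqP; rewrite eq_complex /=; apply/andP; split; apply/eqP; ring.
  have E4 : cpt (shiftN u (- r)) - cpt z = a - I * q.
    by apply/eqP; rewrite eq_complex /=; apply/andP; split; apply/eqP; ring.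
  rewrite E1 E2 E3 E4 -/a -/q.
  have -> : (a + q) * (a - q) * ((a + I * q) * (a - I * q)) =
    (a ^+ 2 - q ^+ 2) * (a ^+ 2 - (I * I) * q ^+ 2) by ring.
  by rewrite II; ring.
by rewrite (le_trans (cabsD _ _))// cabsN !cabs_exp cabs_real.
Qed.

Lemma dst_shift u r : dst (shiftE u r) u = `|r| /\ dst (shiftN u r) u = `|r|.
Proof.
have sq v : dst v u ^+ 2 = r ^+ 2 -> dst v u = `|r|.
  by move=> /(congr1 Num.sqrt); rewrite !sqrtr_sqr ger0_norm ?dst_ge0.
by split; apply: sq; rewrite dst_sqr/=; ring.
Qed.

(** The four-point Laplacian of |u|^2, the source of strict subharmonicity. *)
Lemma four_point_sqr u r :
  cabs (cpt (shiftE u r)) ^+ 2 + cabs (cpt (shiftE u (- r))) ^+ 2 +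
  (cabs (cpt (shiftN u r)) ^+ 2 + cabs (cpt (shiftN u (- r))) ^+ 2) =
  4 * cabs (cpt u) ^+ 2 + 4 * r ^+ 2.
Proof. by rewrite !cabs_sqr /=; ring. Qed.

(** Logarithm of the product formula, with ln(1 + x) <= x. The condition r <= rho/2 keeps the
    shifted points away from z. The error has order r^4, so a gain of order r^2 beats it for small
    r. *)
Lemma four_point_ln u z r (rho : R) :
  0 < r -> r <= rho / 2 -> rho <= dst u z ->
  ln (dst (shiftE u r) z) + ln (dst (shiftE u (- r)) z) +
  (ln (dst (shiftN u r) z) + ln (dst (shiftN u (- r)) z)) <=
  4 * ln (dst u z) + (r / rho) ^+ 4.
Proof.
move=> r0 rrho rhod; have rho0 : 0 < rho by lra.
have d0 : 0 < dst u z by lra.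
have pos v : dst v u = r -> 0 < dst v z.
  by move=> vu; have := dst_triangle v u z; rewrite (dstC u v) vu; lra.
have nr : `|- r| = r by rewrite normrN gtr0_norm.
have pr : `|r| = r by rewrite gtr0_norm.
have [e1 n1] := dst_shift u r; have [e2 n2] := dst_shift u (- r).
rewrite pr in e1 n1; rewrite nr in e2 n2.
have {}e1 := pos _ e1; have {}n1 := pos _ n1.
have {}e2 := pos _ e2; have {}n2 := pos _ n2.
rewrite -!lnM ?posrE ?mulr_gt0//.
apply: (@le_trans _ _ (ln (dst u z ^+ 4 + r ^+ 4))).
  by rewrite ler_ln ?posrE ?mulr_gt0// ?four_point_prod ?ltW// addr_gt0 ?exprn_gt0.
have -> : dst u z ^+ 4 + r ^+ 4 = dst u z ^+ 4 * (1 + (r / dst u z) ^+ 4).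
  by rewrite mulrDr mulr1 expr_div_n mulrCA divff ?mulr1// expf_eq0/= gt_eqF.
have q0 : 0 <= (r / dst u z) ^+ 4 by rewrite exprn_ge0// divr_ge0// ltW.
rewrite lnM ?posrE ?exprn_gt0 ?ltr_pwDl// lnXn// (mulr_natl (ln (dst u z)) 4) lerD2l.
apply: (@le_trans _ _ ((r / dst u z) ^+ 4)).
  by apply: le_ln1Dx; lra.
have le1 : r / dst u z <= r / rho by rewrite ler_pM2l// lef_pV2 ?posrE.
by apply: lerXn2r => //; rewrite nnegrE; apply: divr_ge0; exact: ltW.
Qed.

End FourPoints.

Lemma measurable_dst_sec {R : realType} (w : R * R) : measurable_fun setT (dst w).
Proof.
have mp : measurable_fun setT (pair w : R * R -> (R * R) * (R * R)) by [].
exact: (measurableT_comp (@measurable_dst R) mp).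
Qed.

Lemma fine_mean_le {R : realType} {a b1 b2 b3 b4 : \bar R} {q : R} :
  a \is a fin_num -> b1 \is a fin_num -> b2 \is a fin_num ->
  b3 \is a fin_num -> b4 \is a fin_num ->
  (4%:E * a <= b1 + b2 + (b3 + b4) + q%:E)%E ->
  4 * fine a <= fine b1 + fine b2 + (fine b3 + fine b4) + q.
Proof.
by move: a b1 b2 b3 b4 => [a| |] [b1| |] [b2| |] [b3| |] [b4| |].
Qed.

(** Averaging the four bounds gains eps t from the quadratic terms, and the error q/4 uses up at
    most half of that. *)
Lemma mean_drop {R : realType} {p0 p1 p2 p3 p4 s0 s1 s2 s3 s4 eps q t N : R} :
  p1 + eps * s1 <= N -> p2 + eps * s2 <= N -> p3 + eps * s3 <= N ->
  p4 + eps * s4 <= N -> 4 * p0 <= p1 + p2 + (p3 + p4) + q ->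
  s1 + s2 + (s3 + s4) = 4 * s0 + 4 * t -> q <= 2 * eps * t ->
  p0 + eps * s0 <= N - eps * t / 2.
Proof.
move=> h1 h2 h3 h4 hp /(congr1 ( *%R eps)) hs hq.
by move: hs; rewrite !mulrDr; lra.
Qed.

(** * From a bound on a set of full measure to a bound on a disc *)

Section MaximumPrinciple.
Context {R : realType}.
Implicit Types (u w x y z : (R * R)%type) (r eta : R).
(** The disc of interest has radius [L], and four-point shifts of size at most 1 stay in radius
    [L + 1]. There [cL] makes the kernel nonnegative against [S], while [far] handles the annulus
    between the two circles. *)
Variables (mu : probability (R * R)%type R) (S : set (R * R)) (c E M L : R).
Hypotheses (mS : measurable S) (muS : mu S = 1%E).
Hypothesis SM : forall z, S z -> cabs (cpt z) <= M.
Hypotheses (ML : M < L) (cL : L + 1 + M <= expR c) (far : c - ln (L - M) <= E).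

Local Notation pot w := (\int[mu]_(z in S) skernel c w z)%E.

Hypothesis potS : forall x, S x -> (pot x <= E%:E)%E.

Lemma dst_le_cabs x y : dst x y <= cabs (cpt x) + cabs (cpt y).
Proof. by rewrite /dst (le_trans (cabsD _ _))// cabsN. Qed.

Lemma cabs_le_dst x y : cabs (cpt x) <= dst x y + cabs (cpt y).
Proof. by rewrite -!dst0 dst_triangle. Qed.

Let dstc w z : cabs (cpt w) <= L + 1 -> S z -> dst w z <= expR c.
Proof.
by move=> wL /SM zM; rewrite (le_trans (dst_le_cabs _ _))// (le_trans _ cL)// lerD.
Qed.

Let k0 w z : cabs (cpt w) <= L + 1 -> S z -> (0 <= skernel c w z)%E.
Proof. by move=> wL Sz; apply: skernel_ge0; exact: dstc. Qed.

Let mk w : measurable_fun S (skernel c w).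
Proof. exact: measurable_skernel. Qed.

Let pot0 w : cabs (cpt w) <= L + 1 -> (0 <= pot w)%E.
Proof. by move=> wL; apply: integral_ge0 => z; exact: k0. Qed.

Let intS r : (\int[mu]_(z in S) r%:E = r%:E)%E.
Proof. by rewrite integral_cst//= muS mule1. Qed.

Let SL z : S z -> cabs (cpt z) <= L + 1.
Proof. by move=> /SM zM; move: ML; lra. Qed.

Let S_neq0 : S !=set0.
Proof.
apply/set0P/eqP => S0; move: muS; rewrite S0 measure0 => /eqP.
by rewrite eq_sym onee_eq0.
Qed.

Let E0 : 0 <= E.
Proof.
by have [x Sx] := S_neq0; rewrite -lee_fin (le_trans _ (potS _ Sx))// pot0// SL.
Qed.

Let M0 : 0 <= M.
Proof. by have [x Sx] := S_neq0; rewrite (le_trans (cabs_ge0 (cpt x)))// SM. Qed.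

Lemma pot_away w r : cabs (cpt w) <= L + 1 -> 0 < r ->
  (forall z, S z -> r <= dst w z) -> (pot w <= (c - ln r)%:E)%E.
Proof.
move=> wL r0 rS; rewrite -intS; apply: ge0_le_integral => //.
  by move=> z; exact: k0.
move=> z Sz; have d0 : 0 < dst w z by rewrite (lt_le_trans r0)// rS.
rewrite skernel_neq -?dst_eq0 ?gt_eqF// lee_fin lerD2l lerN2 ler_ln ?posrE//.
exact: rS.
Qed.

Lemma pot_far w : L <= cabs (cpt w) <= L + 1 -> (pot w <= E%:E)%E.
Proof.
move=> /andP[Lw wL]; apply: (@le_trans _ _ (c - ln (L - M))%:E); last first.
  by rewrite lee_fin.
apply: pot_away => //; first by rewrite subr_gt0.
by move=> z Sz; have := cabs_le_dst w z; have := SM _ Sz; lra.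
Qed.

(* Lower semicontinuity, through the kernels regularised by 1/(n+1). *)
Lemma pot_adherent w : cabs (cpt w) <= L ->
  (forall e : R, 0 < e -> exists2 x, S x & dst w x < e) -> (pot w <= E%:E)%E.
Proof.
move=> wL wS.
have rn0 n : (0 : R) < n.+1%:R^-1 by rewrite invr_gt0.
pose h n z : \bar R := (c - ln (dst w z + n.+1%:R^-1))%:E.
have dn n z : 0 < dst w z + n.+1%:R^-1 by rewrite ltr_wpDl// dst_ge0.
have mh n : measurable_fun S (h n).
  apply: measurable_funTS; apply/measurable_EFinP/measurable_funB => //.
  apply: (measurableT_comp (@measurable_ln R)); apply: measurable_funD => //.
  exact: measurable_dst_sec.
(* The regularisation 1/(n+1) <= 1 is absorbed by the margin 1 in [cL]. *)
have h0 n z : S z -> (0 <= h n z)%E.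
  move=> Sz; rewrite lee_fin subr_ge0 -[leRHS](expRK c) ler_ln ?posrE ?expR_gt0//.
  have n1 : (n.+1%:R^-1 : R) <= 1 by rewrite invf_le1// ler1n.
  move: n1 cL (dst_le_cabs w z) (SM _ Sz); move: (n.+1%:R^-1) => t.
  by lra.
have hnd z : S z -> nondecreasing_seq (h ^~ z).
  move=> Sz m n mn; rewrite lee_fin lerD2l lerN2 ler_ln ?posrE// lerD2l.
  by rewrite lef_pV2 ?posrE// ler_nat ltnS.
(* With x in [S] closer to w than 1/(n+1), |x - z| <= |w - z| + 1/(n+1), so [h n] lies below the
   kernel at x, where the bound is known. *)
have hE n : (\int[mu]_(z in S) h n z <= E%:E)%E.
  have [x Sx wx] := wS _ (rn0 n); apply: (le_trans _ (potS _ Sx)).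
  apply: ge0_le_integral => //; first exact: h0.
  move=> z Sz; have [->|xz] := eqVneq x z; first by rewrite skernelxx leey.
  have d0 : 0 < dst x z by rewrite lt_neqAle dst_ge0 eq_sym dst_eq0 xz.
  rewrite skernel_neq// lee_fin lerD2l lerN2 ler_ln ?posrE//.
  move: wx (dst_triangle w x z) (dst_triangle x w z); rewrite (dstC x w).
  by move: (n.+1%:R^-1) => t; lra.
have limh z : S z -> (skernel c w z <= limn (h ^~ z))%E.
  move=> Sz; rewrite (cvg_lim _ (ereal_nondecreasing_cvgn (hnd z Sz)))//.
  (* Stated for every level A below the kernel, which covers the infinite value at w = z as well. *)
  have supA A : dst w z < expR (c - A) -> (A%:E <= ereal_sup (range (h ^~ z)))%E.
    move=> dA; have e0 : 0 < expR (c - A) - dst w z by rewrite subr_gt0.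
    have [n _ nP] := near_infty_natSinv_lt (PosNum e0).
    apply: (@le_trans _ _ (h n z)); last by apply: ereal_sup_ubound; exists n.
    rewrite lee_fin lerBrDl -lerBrDr -[leRHS](expRK (c - A)).
    rewrite ler_ln ?posrE ?expR_gt0//.
    by have := nP n (leqnn n); rewrite /=; move: (n.+1%:R^-1) => t; lra.
  have [wz|wz] := eqVneq w z.
    rewrite [X in skernel c X _]wz skernelxx leye_eq.
    apply/eqP/eqyP => A _; apply: supA.
    by rewrite wz dstxx expR_gt0.
  have d0 : 0 < dst w z by rewrite lt_neqAle dst_ge0 eq_sym dst_eq0 wz.
  rewrite skernel_neq//; apply/lee_addgt0Pr => e e_gt0.
  rewrite -leeBlDr// -EFinB; apply: supA.
  rewrite (_ : c - _ = ln (dst w z) + e); last by ring.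
  by rewrite expRD lnK ?posrE// ltr_pMr// expR_gt1.
apply: (@le_trans _ _ (\int[mu]_(z in S) limn (h ^~ z))%E).
  apply: ge0_le_integral => //.
  - by move=> z Sz; apply: k0 => //; rewrite (le_trans wL)// lerDl.
  - by apply: (emeasurable_fun_cvg h) => // z Sz; exact: ereal_nondecreasing_is_cvgn (hnd z Sz).
rewrite monotone_convergence//; apply: lime_le.
  apply: ereal_nondecreasing_is_cvgn => m n mn; apply: ge0_le_integral => //.
  - exact: h0.
  - by move=> z Sz; exact: hnd.
by apply: nearW => n; exact: hE.
Qed.

(* If [w] in [S] is closest to [u] up to a factor 2 then |w - z| <= 3 |u - z| on
   [S]; the loss ln 3 is only paid on a disc around [w], whose mass is small since
   [pot w <= E]. *)
Lemma pot_near eta : 0 < eta -> exists2 rho : R, 0 < rho & forall u x r,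
  cabs (cpt u) <= L + 1 -> 0 < r -> (forall z, S z -> r <= dst u z) ->
  S x -> dst u x < rho -> (pot u <= (E + eta)%:E)%E.
Proof.
move=> eta0; pose l3 := ln (3 : R); have l30 : 0 <= l3 by rewrite ln_ge0// ler1n.
(* Chosen so that a disc of mass at most E/(1 + q) contributes at most eta/2 through the loss ln
   3. *)
pose q : R := 2 * l3 * E / eta.
have q0 : 0 <= q by rewrite divr_ge0 ?(ltW eta0)// !mulr_ge0.
have qE : l3 * E = q * (eta / 2) by rewrite /q; field; rewrite gt_eqF.
pose t := 1 + q; have t0 : 0 < t by rewrite ltr_pwDl.
(* The kernel at w is at least t within this distance. *)
pose del := expR (c - t); have del0 : 0 < del by exact: expR_gt0.
pose e := expR (- (eta / 2)); have e0 : 0 < e by exact: expR_gt0.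
have e1 : e < 1 by rewrite expR_lt1 oppr_lt0 divr_gt0.
exists (del * (1 - e) / 2); first by rewrite divr_gt0// mulr_gt0// subr_gt0.
move=> u x r uL r0 ur Sx ux.
pose I := inf [set dst u z | z in S].
have A0 : [set dst u z | z in S] !=set0 by exists (dst u x), x.
have Ilb z : S z -> I <= dst u z.
  by move=> Sz; apply: ge_inf; [exists r => _ [y Sy <-]; exact: ur|exists z].
have I0 : 0 < I.
  by apply: (lt_le_trans r0); apply: lb_le_inf => // _ [z Sz <-]; exact: ur.
(* The distance from u to [S] need not be attained; as it is positive, some w in [S] lies at less
   than twice that distance. *)
have [_ [w Sw <-] wI] := inf_adherent I0
  (conj A0 (ex_intro _ r (fun _ '(ex_intro2 z Sz dz) =>
    eq_ind _ (fun v => r <= v) (ur z Sz) _ dz)) : has_inf [set dst u z | z in S]).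
have w2 z : S z -> dst u w <= 2 * dst u z.
  by move=> Sz; move: wI (Ilb _ Sz); rewrite -/I; lra.
pose B := S `&` [set z | dst w z < del].
have mB : measurable B.
  rewrite (_ : B = S `&` (dst w @^-1` `]-oo, del[%classic)).
    have mdS : measurable_fun S (dst w).
      by apply: measurable_funTS; exact: measurable_dst_sec.
    by apply: mdS => //; exact: measurable_itv.
  by apply/seteqP; split => z [Sz]; rewrite /= ?in_itv.
have key z : S z ->
    (skernel c u z <= skernel c w z + ((l3 * \1_B z)%:E + (eta / 2)%:E))%E.
  move=> Sz; have [<-|wz] := eqVneq w z; first by rewrite skernelxx addye// leey.
  have du0 : 0 < dst u z by rewrite (lt_le_trans r0)// ur.
  have uz : u != z by rewrite -dst_eq0 gt_eqF.
  have dw0 : 0 < dst w z by rewrite lt_neqAle dst_ge0 eq_sym dst_eq0 wz.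
  rewrite !skernel_neq// -!EFinD lee_fin indicE.
  have tri := dst_triangle u w z; rewrite (dstC w u) in tri.
  have [zB|zB] := boolP (z \in B).
    have : ln (dst w z) <= ln (3 * dst u z).
      by rewrite ler_ln ?posrE ?mulr_gt0//; have := w2 _ Sz; move: tri; lra.
    by rewrite lnM ?posrE//= -/l3; move: eta0; lra.
  have dwz : del <= dst w z.
    by rewrite leNgt; apply: contraNN zB => h; rewrite inE; split.
  (* Outside the disc, |u - w| <= 2|u - x| < del(1 - e) <= (1 - e)|w - z|. Hence |u - z| >= e|w -
     z|, and the loss is - ln e = eta/2. *)
  have : ln (e * dst w z) <= ln (dst u z).
    rewrite ler_ln ?posrE ?mulr_gt0//.
    have h1 : del * (1 - e) <= dst w z * (1 - e) by rewrite ler_pM2r// subr_gt0.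
    have h2 := w2 _ Sx.
    have h3 : dst w z * (1 - e) = dst w z - e * dst w z by ring.
    by move: ux tri h1 h2 h3; lra.
  by rewrite lnM ?posrE// expRK /=; lra.
have mind : measurable_fun S (fun z => (l3 * \1_B z)%:E).
  apply: measurable_funTS; apply/measurable_EFinP/measurable_funM => //.
have ind0 z : S z -> (0 <= (l3 * \1_B z)%:E)%E by rewrite lee_fin mulr_ge0.
have uw : (pot u <= pot w + ((l3 * fine (mu B))%:E + (eta / 2)%:E))%E.
  have -> : ((l3 * fine (mu B))%:E = \int[mu]_(z in S) (l3 * \1_B z)%:E)%E.
    under eq_integral do rewrite EFinM.
    have m1 : measurable_fun S (fun z => (\1_B z : R)%:E).
      by apply: measurable_funTS; apply/measurable_EFinP.
    rewrite ge0_integralZl_EFin//.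
    rewrite integral_indic// setIAC setIid EFinM fineK//; exact: fin_num_measure.
  have e2 : 0 <= eta / 2 by rewrite divr_ge0// ltW.
  have in0 z : S z -> (0 <= (l3 * \1_B z)%:E + (eta / 2)%:E)%E.
    by move=> Sz; rewrite adde_ge0// ?ind0// lee_fin.
  have min : measurable_fun S (fun z => (l3 * \1_B z)%:E + (eta / 2)%:E)%E.
    exact: emeasurable_funD.
  rewrite -(intS (eta / 2)) -!ge0_integralD//; last by move=> z; apply: k0; exact: SL.
  apply: ge0_le_integral => //; first by move=> z; exact: k0.
  exact: emeasurable_funD.
(* Chebyshev's inequality for the kernel at w, which is at least t on [B]. *)
have muB : fine (mu B) * t <= E.
  rewrite -lee_fin mulrC EFinM fineK; last exact: fin_num_measure.
  rewrite -integral_cst//; apply: (le_trans _ (potS _ Sw)).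
  apply: (@le_trans _ _ (\int[mu]_(z in B) skernel c w z)%E); last first.
    by apply: ge0_subset_integral => // [z|z []//]; apply: k0; exact: SL.
  apply: ge0_le_integral => //.
  - by move=> z _; rewrite lee_fin ltW.
  - exact: measurable_skernel.
  - move=> z [Sz zd]; have [<-|wz] := eqVneq w z; first by rewrite skernelxx leey.
    have dw0 : 0 < dst w z by rewrite lt_neqAle dst_ge0 eq_sym dst_eq0 wz.
    rewrite skernel_neq// lee_fin lerBrDr -lerBrDl -[leRHS](expRK (c - t)).
    by rewrite ler_ln ?posrE ?expR_gt0// ltW.
apply: (le_trans uw); rewrite (_ : E + eta = E + (eta / 2 + eta / 2)); last by field.
rewrite !EFinD leeD ?potS// leeD2r// lee_fin -(ler_pM2r t0).
rewrite -mulrA (le_trans (ler_wpM2l l30 muB))// qE mulrC ler_wpM2l ?divr_ge0 ?ltW//.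
by rewrite /t; lra.
Qed.

Let shift_cabs u r : cabs (cpt u) <= L -> 0 < r <= 1 ->
  [/\ cabs (cpt (shiftE u r)) <= L + 1, cabs (cpt (shiftE u (- r))) <= L + 1,
      cabs (cpt (shiftN u r)) <= L + 1 & cabs (cpt (shiftN u (- r))) <= L + 1].
Proof.
move=> uL /andP[r0 r1].
have b v : dst v u = r -> cabs (cpt v) <= L + 1.
  by move=> vu; rewrite (le_trans (cabs_le_dst v u))// vu addrC lerD.
have [e1 n1] := dst_shift u r; have [e2 n2] := dst_shift u (- r).
rewrite gtr0_norm// in e1 n1; rewrite normrN gtr0_norm// in e2 n2.
by split; exact: b.
Qed.

Let pot_fin w r : cabs (cpt w) <= L + 1 -> 0 < r ->
  (forall z, S z -> r <= dst w z) -> pot w \is a fin_num.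
Proof.
move=> wL r0 rS; rewrite ge0_fin_numE; last exact: pot0.
by rewrite (le_lt_trans (pot_away _ _ wL r0 rS))// ltry.
Qed.

Let fpot w := fine (pot w).

(** Integrate [four_point_ln] over [S]: the shifts by c cancel, and the error is unchanged because
    [S] has mass 1. *)
Lemma pot_mean u r rho : cabs (cpt u) <= L -> 0 < r <= 1 -> r <= rho / 2 ->
  (forall z, S z -> rho <= dst u z) ->
  4 * fpot u <= fpot (shiftE u r) + fpot (shiftE u (- r)) +
    (fpot (shiftN u r) + fpot (shiftN u (- r))) + (r / rho) ^+ 4.
Proof.
move=> uL r01 rrho uS; have [c1 c2 c3 c4] := shift_cabs _ _ uL r01.
have /andP[r0 r1] := r01.
have uL1 : cabs (cpt u) <= L + 1 by rewrite (le_trans uL)// lerDl.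
have rho0 : 0 < rho by move: r0 rrho; lra.
have away v : dst v u = r -> forall z, S z -> r <= dst v z.
  move=> vu z Sz; have := dst_triangle v u z; rewrite (dstC u v) vu.
  by move: (uS _ Sz) rrho; lra.
have [e1 n1] := dst_shift u r; have [e2 n2] := dst_shift u (- r).
rewrite gtr0_norm// in e1 n1; rewrite normrN gtr0_norm// in e2 n2.
have a1 := away _ e1; have a2 := away _ e2; have a3 := away _ n1; have a4 := away _ n2.
have q0 : 0 <= (r / rho) ^+ 4 by rewrite exprn_ge0// divr_ge0// ltW.
have f0 := pot_fin _ _ uL1 rho0 uS.
have f1 := pot_fin _ _ c1 r0 a1; have f2 := pot_fin _ _ c2 r0 a2.
have f3 := pot_fin _ _ c3 r0 a3; have f4 := pot_fin _ _ c4 r0 a4.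
apply: (fine_mean_le f0 f1 f2 f3 f4).
rewrite -(intS ((r / rho) ^+ 4)) -ge0_integralZl_EFin//; last by move=> z; exact: k0.
have h1 z : S z -> (0 <= skernel c (shiftE u r) z)%E by exact: k0.
have h2 z : S z -> (0 <= skernel c (shiftE u (- r)) z)%E by exact: k0.
have h3 z : S z -> (0 <= skernel c (shiftN u r) z)%E by exact: k0.
have h4 z : S z -> (0 <= skernel c (shiftN u (- r)) z)%E by exact: k0.
rewrite -(ge0_integralD mu mS h1 _ h2)// -(ge0_integralD mu mS h3 _ h4)//.
have h12 z : S z -> (0 <= skernel c (shiftE u r) z + skernel c (shiftE u (- r)) z)%E.
  by move=> Sz; rewrite adde_ge0// ?h1// h2.
have h34 z : S z -> (0 <= skernel c (shiftN u r) z + skernel c (shiftN u (- r)) z)%E.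
  by move=> Sz; rewrite adde_ge0// ?h3// h4.
have m12 : measurable_fun S (fun z => skernel c (shiftE u r) z + skernel c (shiftE u (- r)) z)%E.
  exact: emeasurable_funD.
have m34 : measurable_fun S (fun z => skernel c (shiftN u r) z + skernel c (shiftN u (- r)) z)%E.
  exact: emeasurable_funD.
rewrite -(ge0_integralD mu mS h12 _ h34)//.
have m1234 := emeasurable_funD m12 m34.
rewrite -ge0_integralD//; last by move=> z Sz; rewrite adde_ge0// ?h12// h34.
apply: ge0_le_integral => //.
- by move=> z Sz; rewrite mule_ge0// k0.
- exact: measurable_funeM.
- exact: emeasurable_funD.
move=> z Sz.
have neq v (s : R) : 0 < s -> s <= dst v z -> v != z.
  by move=> s0 sv; rewrite -dst_eq0 gt_eqF// (lt_le_trans s0).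
rewrite !skernel_neq ?(neq _ _ rho0 (uS _ Sz)) ?(neq _ _ r0 (a1 _ Sz))
  ?(neq _ _ r0 (a2 _ Sz)) ?(neq _ _ r0 (a3 _ Sz)) ?(neq _ _ r0 (a4 _ Sz))//.
rewrite -EFinM -!EFinD lee_fin.
by have := four_point_ln _ _ _ _ r0 rrho (uS _ Sz); lra.
Qed.

(* [w |-> pot w + eps |w|^2] has strictly positive four point Laplacian off [S],
   so it cannot be maximal away from [S] and from the circle of radius [L]. *)
Theorem pot_le w : cabs (cpt w) <= L -> (pot w <= E%:E)%E.
Proof.
move=> wL; have [adh|nadh] := pselect (forall e : R, 0 < e -> exists2 x, S x & dst w x < e).
  exact: pot_adherent.
have [e0 e00 we0] : exists2 e : R, 0 < e & forall x, S x -> e <= dst w x.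
  move/existsNP: nadh => [e /not_implyP[e0 h]]; exists e => // x Sx.
  by rewrite leNgt; apply/negP => wx; apply: h; exists x.
apply/lee_addgt0Pr => eta eta0; rewrite -EFinD.
have eta20 : 0 < eta / 2 by rewrite divr_gt0.
have [rho1 rho10 near_le] := pot_near _ eta20.
have L0 : 0 < L by exact: le_lt_trans ML.
have L10 : 0 < L + 1 by rewrite addr_gt0.
(* The quadratic term is then at most eta/2 on the disc of radius L + 1. *)
pose eps := eta / 2 / (L + 1) ^+ 2.
have eps0 : 0 < eps by rewrite divr_gt0// exprn_gt0.
pose rho := Num.min e0 rho1; have rho0 : 0 < rho by rewrite lt_min e00.
(* The three bounds keep the shifts in radius L + 1, keep them away from [S], and, as r^2 <= r, make
   the fourth-order error at most 2 eps r^2. *)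
pose r := Num.min 1 (Num.min (rho / 2) (2 * eps * rho ^+ 4)).
have r0 : 0 < r.
  rewrite !lt_min ltr01 divr_gt0//=; apply: mulr_gt0; last exact: exprn_gt0.
  exact: mulr_gt0.
have r1 : r <= 1 by rewrite ge_min lexx.
have r2 : r <= rho / 2 by rewrite !ge_min lexx orbT.
have r3 : r <= 2 * eps * rho ^+ 4 by rewrite !ge_min lexx !orbT.
have err : (r / rho) ^+ 4 <= 2 * eps * r ^+ 2.
  have rr : r ^+ 2 <= 2 * eps * rho ^+ 4.
    by apply: (le_trans _ r3); rewrite expr2 ler_piMl// ltW.
  rewrite expr_div_n ler_pdivrMr ?exprn_gt0//.
  have -> : r ^+ 4 = r ^+ 2 * r ^+ 2 by ring.
  have -> : 2 * eps * r ^+ 2 * rho ^+ 4 = r ^+ 2 * (2 * eps * rho ^+ 4) by ring.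
  by rewrite ler_pM2l// exprn_gt0.
pose D : set (R * R) := [set u | cabs (cpt u) <= L /\ forall z, S z -> rho <= dst u z].
pose f u := fpot u + eps * cabs (cpt u) ^+ 2.
have Dw : D w by split=> // z Sz; rewrite ge_min we0.
have epsL u : cabs (cpt u) <= L + 1 -> eps * cabs (cpt u) ^+ 2 <= eta / 2.
  move=> uL; rewrite /eps -mulrA ler_piMr ?(ltW eta20)// mulrC.
  rewrite ler_pdivrMr ?exprn_gt0// mul1r.
  by apply: lerXn2r => //; rewrite nnegrE ?cabs_ge0// ltW.
have DL u : D u -> cabs (cpt u) <= L + 1 by case=> uL _; rewrite (le_trans uL)// lerDl.
have fub u : D u -> f u <= c - ln rho + eta / 2.
  move=> Du; apply: lerD; last exact/epsL/DL.
  rewrite -lee_fin /fpot fineK; first exact: pot_away (DL _ Du) rho0 Du.2.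
  exact: pot_fin (DL _ Du) rho0 Du.2.
have hs : has_sup [set f u | u in D].
  by split; [exists (f w), w|exists (c - ln rho + eta / 2) => _ [u Du <-]; exact: fub].
(* No maximum point is needed: the drop found below is the same for every u in [D], so it
   contradicts the definition of the supremum. *)
pose N := sup [set f u | u in D].
have fN u : D u -> f u <= N by move=> Du; apply: sup_upper_bound => //; exists u.
suff NE : N <= E + eta.
  rewrite -(fineK (pot_fin _ _ (DL _ Dw) rho0 Dw.2)) lee_fin.
  apply: le_trans (le_trans (fN _ Dw) NE); rewrite lerDl.
  by rewrite mulr_ge0 ?(ltW eps0)// exprn_ge0// cabs_ge0.
rewrite leNgt; apply/negP => EN.
(* A shift can leave [D] across the circle of radius [L], where [pot_far] applies, or by coming
   close to [S], where [pot_near] applies. Either way [f v] is at most E + eta < N. *)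
have outer v : cabs (cpt v) <= L + 1 -> (forall z, S z -> r <= dst v z) -> f v <= N.
  move=> vL vr; have [Dv|Dv] := pselect (D v); first exact: fN.
  apply: (le_trans _ (ltW EN)); rewrite (_ : E + eta = E + eta / 2 + eta / 2); last by field.
  apply: lerD; last exact: epsL.
  rewrite -lee_fin /fpot (fineK (pot_fin _ _ vL r0 vr)).
  have [vL'|Lv] := leP (cabs (cpt v)) L; last first.
    apply: (@le_trans _ _ E%:E); first by apply: pot_far; rewrite vL ltW.
    by rewrite lee_fin lerDl ltW.
  have [x Sx vx] : exists2 x, S x & dst v x < rho.
    apply: contrapT => h; apply: Dv; split => // z Sz; rewrite leNgt.
    by apply/negP => vz; apply: h; exists z.
  by apply: (near_le v x r) => //; rewrite (lt_le_trans vx)// ge_min lexx orbT.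
have drop u : D u -> f u <= N - eps * r ^+ 2 / 2.
  move=> Du; have [uL uS] := Du; have r01 : 0 < r <= 1 by rewrite r0.
  have [c1 c2 c3 c4] := shift_cabs _ _ uL r01.
  have away v : dst v u = r -> forall z, S z -> r <= dst v z.
    move=> vu z Sz; have := dst_triangle v u z; rewrite (dstC u v) vu.
    by move: (uS _ Sz) r2; lra.
  have [e1 n1] := dst_shift u r; have [e2 n2] := dst_shift u (- r).
  rewrite gtr0_norm// in e1 n1; rewrite normrN gtr0_norm// in e2 n2.
  exact: (mean_drop (outer _ c1 (away _ e1)) (outer _ c2 (away _ e2))
    (outer _ c3 (away _ n1)) (outer _ c4 (away _ n2))
    (pot_mean _ _ _ uL r01 r2 uS) (four_point_sqr u r) err).
have : N <= N - eps * r ^+ 2 / 2.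
  by apply: ge_sup; [exists (f w), w|move=> _ [u Du <-]; exact: drop].
by rewrite leNgt gtrDl oppr_lt0 divr_gt0// mulr_gt0// exprn_gt0.
Qed.

End MaximumPrinciple.

(** * Potential of the equilibrium measure *)

Section EquilibriumMeasure.
Context {R : realType}.
Implicit Types (u w x y z : (R * R)%type).

Lemma maxmod_ge (K : set (R * R)) z : compact K -> K z -> cabs (cpt z) <= maxmod K.
Proof.
move=> /compact_bounded_plane[M M0 KM] Kz.
apply: sup_upper_bound; last by exists z.
by split; [exists (cabs (cpt z)), z|exists M => _ [y Ky <-]; exact: KM].
Qed.

Lemma log_cap_gt0 (K : set (R * R)) : non_polar K ->
  exists2 V : R, robin K = V%:E & log_cap K = expR (- V).
Proof.
rewrite /non_polar /log_cap; case: (robin K) => [V _| |]; rewrite ?ltxx//.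
by exists V.
Qed.

Variables (K : set (R * R)) (mu : probability (R * R)%type R) (V : R).
Hypotheses (cK : compact K) (muK : prob_on K mu) (muV : log_energy mu = V%:E).
Hypothesis Vmin : forall nu, prob_on K nu -> (V%:E <= log_energy nu)%E.

Let mK : measurable K := compact_measurable_plane _ cK.

Let muKC : mu (~` K) = 0%E := probability_compl mu K mK muK.

Lemma frostman w : exists c : R, [/\ 0 <= c,
  forall z, K z -> dst w z <= expR c &
  (\int[mu]_(z in K) skernel c w z <= (V + c)%:E)%E].
Proof.
have [M M0 KM] := compact_bounded_plane _ cK.
(* The disc must contain w, and L - M >= exp(- V) is what the hypothesis [far] asks for. *)
pose L := Num.max (cabs (cpt w)) (M + expR (- V)).
have wL : cabs (cpt w) <= L by rewrite le_max lexx.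
have ML : M + expR (- V) <= L by rewrite le_max lexx orbT.
have V0 := expR_gt0 (- V).
have L0 : 0 < L by move: ML V0 M0; lra.
pose c := ln (2 * (L + 1 + M)).
have LM1 : 1 <= 2 * (L + 1 + M) by move: L0 M0; lra.
have cE : expR c = 2 * (L + 1 + M) by rewrite lnK// posrE (lt_le_trans _ LM1).
have c0 : 0 <= c by rewrite ln_ge0.
have dc u z : cabs (cpt u) <= L + 1 -> K z -> dst u z <= expR c.
  move=> uL /KM zM; rewrite (le_trans (dst_le_cabs _ _))// cE.
  by move: uL zM L0 M0; lra.
have KL x : K x -> cabs (cpt x) <= L + 1 by move=> /KM; move: ML V0; lra.
have [mS muS] := equilibrium_potential_le K c mK c0
  (fun x y Kx Ky => dc x y (KL x Kx) Ky) mu V muK muV Vmin.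
set S := _ `&` _ in mS muS.
have SK : S `<=` K by move=> x [].
have SKint u : cabs (cpt u) <= L + 1 ->
    (\int[mu]_(z in K) skernel c u z = \int[mu]_(z in S) skernel c u z)%E.
  move=> uL; rewrite (@ge0_negligible_integral _ _ _ mu K (~` S))//.
  - by rewrite setDE setCK setIidr.
  - exact: measurableC.
  - exact: measurable_skernel.
  - by move=> z Kz; apply: skernel_ge0; exact: dc.
  - exact: probability_compl.
exists c; split=> //; first by move=> z; apply: dc; rewrite (le_trans wL)// lerDl.
rewrite SKint; last by rewrite (le_trans wL)// lerDl.
apply: (@pot_le _ mu S c (V + c) M L) => //.
- by move=> z /SK /KM.
- by move: ML V0; lra.
- by rewrite cE; move: L0 M0; lra.
- rewrite addrC lerD2r lerNl -[leLHS](expRK (- V)) ler_ln ?posrE//.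
  + by move: ML; lra.
  + by move: ML V0; lra.
- by move=> x [Kx h]; rewrite -SKint//; exact: KL.
Qed.

(** On [K] the absolute value of the kernel is at most the shifted kernel plus c, whose integral is
    finite by [frostman]. *)
Lemma integrable_logkernel w : mu.-integrable setT (fun z => - logkernel (w, z))%E.
Proof.
have [c [c0 dc pc]] := frostman w.
have mk := measurable_logkernel_sec w.
have msk := measurable_skernel c w K.
have sk0 z : K z -> (0 <= skernel c w z)%E by move=> Kz; apply: skernel_ge0; exact: dc.
apply: (@eq_integrable _ _ _ mu setT measurableT (\- (fun z => logkernel (w, z)))%E) => //.
apply: integrableN; apply/integrableP; split => //.
rewrite (@ge0_integral_full _ _ _ mu K)//; last exact: measurableT_comp.
apply: (@le_lt_trans _ _ (\int[mu]_(z in K) (skernel c w z + c%:E))%E).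
  apply: ge0_le_integral => //.
  - by apply: measurable_funTS; exact: measurableT_comp.
  - exact: emeasurable_funD.
  move=> z /sk0; rewrite /skernel; case: (logkernel _) => [v| |]//=.
  by rewrite -!EFinD !lee_fin ler_norml => ?; apply/andP; split; move: c0; lra.
rewrite ge0_integralD// integral_cst// [X in (_ * X)%E]muK mule1.
by rewrite lte_add_pinfty ?ltry// (le_lt_trans pc)// ltry.
Qed.

Let intK (f : R * R -> \bar R) : mu.-integrable setT f ->
  (\int[mu]_z f z = \int[mu]_(z in K) f z)%E.
Proof.
move=> fi; rewrite (@negligible_integral _ _ _ mu setT (~` K))//.
  by rewrite setTD setCK.
exact: measurableC.
Qed.

(** This is - p(w); its exponential is the Mahler measure of the linear factor X - w. *)
Definition lpot w : R := fine (\int[mu]_z (- logkernel (w, z)))%E.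

Lemma lpotE w : (\int[mu]_z (- logkernel (w, z)) = (lpot w)%:E)%E.
Proof. by rewrite /lpot fineK// integrable_fin_num//; exact: integrable_logkernel. Qed.

Lemma lpot_ge w : - V <= lpot w.
Proof.
have [c [c0 dc pc]] := frostman w.
have mk := measurable_logkernel_sec w.
have intN : (\int[mu]_z logkernel (w, z) = (- lpot w)%:E)%E.
  rewrite EFinN -lpotE -integralN/=.
    by apply: eq_integral => z _; rewrite oppeK.
  by apply: integrable_add_def => //; exact: integrable_logkernel.
move: pc; rewrite (integral_shift _ _ _ _ mK muK muKC mk c0) ?intN.
  by rewrite -EFinD lee_fin lerD2r lerNl.
by move=> z Kz; apply: skernel_ge0; exact: dc.
Qed.

(** Frostman's bound at the origin, where the kernel is at least - ln M on [K]. *)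
Lemma log_cap_le_radius (M : R) : 0 < M -> (forall z, K z -> cabs (cpt z) <= M) ->
  expR (- V) <= M.
Proof.
move=> M0 KM; have [c [c0 dc pc]] := frostman (0, 0).
rewrite -[leRHS]lnK ?posrE// ler_expR lerNl -(lerD2r c) -lee_fin.
apply: (le_trans _ pc).
rewrite -[leLHS]mule1 -[X in (_ * X)%E]muK -integral_cst//.
have sk0 z : K z -> (0 <= skernel c (0%R, 0%R) z)%E.
  by move=> Kz; apply: skernel_ge0; exact: dc.
(* Monotonicity of the integral is used for nonnegative functions only; if the constant is not
   positive, the bound is immediate. *)
have [neg|pos] := leP (- ln M + c) 0.
  rewrite integral_cst// (@le_trans _ _ 0%E)//; last exact: integral_ge0.
  by rewrite mule_le0_ge0// lee_fin.
apply: ge0_le_integral => //.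
- by move=> z _; rewrite lee_fin ltW.
- exact: measurable_skernel.
move=> z Kz; have [<-|zz] := eqVneq (0, 0) z; first by rewrite skernelxx leey.
have d0 : 0 < dst (0, 0) z by rewrite lt_neqAle dst_ge0 eq_sym dst_eq0 zz.
rewrite skernel_neq// lee_fin addrC lerD2l lerN2 ler_ln ?posrE//.
by rewrite dstC dst0 KM.
Qed.

Definition circle_inversion (r : R) w : R * R :=
  (r ^+ 2 * w.1 / cabs (cpt w) ^+ 2, r ^+ 2 * w.2 / cabs (cpt w) ^+ 2).

(* With w' = r^2 / conj(w) the inequality reads |r^2 - conj(w) z| <= r |w - z| when
   |z| <= r <= |w|. *)
Lemma dst_reflect w z (r : R) : 0 < r -> r <= cabs (cpt w) -> cabs (cpt z) <= r ->
  cabs (cpt w) / r * dst (circle_inversion r w) z <= dst w z.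
Proof.
move=> r0 rw zr; have w0 : 0 < cabs (cpt w) by exact: lt_le_trans rw.
rewrite mulrAC ler_pdivrMr//.
rewrite -(@ler_pXn2r _ 2) ?nnegrE ?mulr_ge0 ?dst_ge0 ?(ltW r0) ?(ltW w0)//.
rewrite !exprMn !dst_sqr /circle_inversion/=.
have rw2 : r ^+ 2 <= cabs (cpt w) ^+ 2 by apply: lerXn2r; rewrite ?nnegrE ?(ltW r0) ?(ltW w0).
have zr2 : cabs (cpt z) ^+ 2 <= r ^+ 2.
  by apply: lerXn2r; rewrite ?nnegrE ?(ltW r0) ?cabs_ge0.
have n0 : 0 < cabs (cpt w) ^+ 2 by rewrite exprn_gt0.
have nE : cabs (cpt w) ^+ 2 = w.1 ^+ 2 + w.2 ^+ 2 by rewrite cabs_sqr.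
move: zr2 rw2 n0 nE; rewrite [cabs (cpt z) ^+ 2]cabs_sqr /=.
move: (cabs (cpt w) ^+ 2) => n zr2 rw2 n0 nE.
rewrite -subr_ge0.
have -> : ((w.1 - z.1) ^+ 2 + (w.2 - z.2) ^+ 2) * r ^+ 2 -
  n * ((r ^+ 2 * w.1 / n - z.1) ^+ 2 + (r ^+ 2 * w.2 / n - z.2) ^+ 2) =
  (r ^+ 2 - (z.1 ^+ 2 + z.2 ^+ 2)) * (n - r ^+ 2).
  have E (a b : R) : n * (r ^+ 2 * a / n - b) ^+ 2 =
      (r ^+ 2) ^+ 2 * (a ^+ 2 / n) - 2 * r ^+ 2 * (a * b) + n * b ^+ 2.
    by field; rewrite gt_eqF.
  rewrite mulrDr !E.
  have h : w.1 ^+ 2 / n + w.2 ^+ 2 / n = 1 by rewrite -mulrDl -nE divff// gt_eqF.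
  have -> : w.1 ^+ 2 / n = 1 - w.2 ^+ 2 / n by rewrite -h addrK.
  by rewrite nE; ring.
by rewrite mulr_ge0// subr_ge0.
Qed.

(** Integrating [dst_reflect] bounds [lpot w] below by its value at the reflected point plus
    ln(|w|/r); [lpot_ge] at the reflected point finishes. *)
Lemma lpot_ge_reflect w (r : R) : 0 < r -> (forall z, K z -> cabs (cpt z) <= r) ->
  r <= cabs (cpt w) -> ln (cabs (cpt w) / r) - V <= lpot w.
Proof.
move=> r0 Kr rw; have w0 : 0 < cabs (cpt w) by exact: lt_le_trans rw.
pose w' := circle_inversion r w.
apply: (@le_trans _ _ (ln (cabs (cpt w) / r) + lpot w')).
  by rewrite lerD2l lpot_ge.
have q0 : 0 < cabs (cpt w) / r by rewrite divr_gt0.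
rewrite -lee_fin EFinD -!lpotE.
have iw := integrable_logkernel w; have iw' := integrable_logkernel w'.
have ic : mu.-integrable setT (fun=> (ln (cabs (cpt w) / r))%:E).
  exact: finite_measure_integrable_cst.
have -> : ((ln (cabs (cpt w) / r))%:E = \int[mu]_z (ln (cabs (cpt w) / r))%:E)%E.
  by rewrite integral_cst// [X in (_ * X)%E](_ : _ = 1%E) ?mule1//; exact: probability_setT.
have iD := integrableD measurableT ic iw'.
rewrite -integralD// (intK _ iw) (intK _ iD).
apply: le_integral => //.
- exact: (@integrableS _ _ _ mu setT).
- exact: (@integrableS _ _ _ mu setT).
move=> z /set_mem Kz; have dd := dst_reflect w z r r0 rw (Kr _ Kz).
rewrite -/w' in dd.
have [<-|zw'] := eqVneq w' z; first by rewrite logkernelxx addeNy leNye.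
have d'0 : 0 < dst w' z by rewrite lt_neqAle dst_ge0 eq_sym dst_eq0 zw'.
have d0 : 0 < dst w z by rewrite (lt_le_trans _ dd)// mulr_gt0.
rewrite !logkernel_neq// -?dst_eq0 ?gt_eqF// -!EFinN !opprK -EFinD lee_fin.
by rewrite -lnM ?posrE// ler_ln ?posrE// mulr_gt0.
Qed.

End EquilibriumMeasure.

(** * Polynomials *)

Section PolynomialCoefficients.
Context {R : realType}.
Implicit Types (s : seq R[i]) (r : R).

(** Induction on the roots with Pascal's rule: m = max(1, |a|/r) satisfies both 1 <= m and |a| <= r
    m, so it pays for the multiplication by X and by the root. *)
Lemma cabs_prodXsub_coef s r k : 0 < r ->
  cabs (\prod_(a <- s) ('X - a%:P))`_k <=
  'C(size s, k)%:R * r ^+ (size s - k) * \prod_(a <- s) Num.max 1 (cabs a / r).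
Proof.
move=> r0; elim: s k => [|a s IH] k.
  rewrite !big_nil coef1 mulr1 bin0n; have [->|k0] := eqVneq k 0%N.
    by rewrite cabs1 mul1r expr0.
  by rewrite cabs0 mul0r.
rewrite !big_cons mulrBl coefB coefCM [size _]/=.
set Q := \prod_(j <- s) _ in IH *; set m := Num.max _ _.
set Pi := \prod_(j <- s) _ in IH *.
have Pi0 : 0 <= Pi by apply: prodr_ge0 => b _; rewrite le_max ler01.
have m1 : 1 <= m by rewrite le_max lexx.
have ma : cabs a <= r * m.
  by rewrite mulrC -ler_pdivrMr// le_max lexx orbT.
have m0 : 0 <= m by rewrite (le_trans ler01).
have low : cabs (a * Q`_k) <= 'C(size s, k)%:R * r ^+ ((size s).+1 - k) * (m * Pi).
  (* For k > [size s] both sides are 0: the binomial vanishes, and [IH] then kills the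
     coefficient. *)
  rewrite cabsM; have [ks|ks] := leqP k (size s); last first.
    have := IH k; rewrite bin_small// !mul0r => Q0.
    have -> : cabs Q`_k = 0 by apply/eqP; rewrite eq_le Q0 cabs_ge0.
    by rewrite mulr0.
  rewrite subSn// exprS.
  have -> : 'C(size s, k)%:R * (r * r ^+ (size s - k)) * (m * Pi) =
    (r * m) * ('C(size s, k)%:R * r ^+ (size s - k) * Pi) by ring.
  by apply: ler_pM => //; exact: cabs_ge0.
rewrite (le_trans (cabsD _ _))// cabsN coefXM.
case: k low => [|k] low; first by rewrite eqxx cabs0 add0r bin0; rewrite bin0 in low.
rewrite -[k.+1 == 0%N]/false succnK.
rewrite binS natrD mulrDl mulrDl addrC lerD// subSS.
apply: (le_trans (IH k)); rewrite ler_wpM2l ?mulr_ge0 ?exprn_ge0 ?(ltW r0)//.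
by rewrite ler_peMl.
Qed.

Definition plane (a : R[i]) : R * R := (complex.Re a, complex.Im a).

Lemma planeK a : cpt (plane a) = a.
Proof. by case: a. Qed.

(** This includes the zeros: -oo absorbs, and no value is +oo. *)
Lemma logabs_polyM (P Q : {poly R[i]}) z :
  logabs_poly (P * Q) z = (logabs_poly P z + logabs_poly Q z)%E.
Proof.
rewrite /logabs_poly hornerM cabsM mulf_eq0.
case: ifPn => [/orP[->|->]|].
- by case: ifPn.
- by case: ifPn.
rewrite negb_or => /andP[p0 q0]; rewrite (negbTE p0) (negbTE q0) -EFinD.
by rewrite lnM ?posrE// lt_neqAle eq_sym ?p0 ?q0 cabs_ge0.
Qed.

Lemma logabs_polyXsubC a z :
  logabs_poly ('X - a%:P) z = (- logkernel (plane a, z))%E.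
Proof.
rewrite /logabs_poly hornerXsubC logkernelE dstC /dst planeK.
by case: ifPn => //= _; rewrite opprK.
Qed.

Lemma logabs_poly_factored a s z : a != 0 ->
  logabs_poly (a *: \prod_(b <- s) ('X - b%:P)) z =
  ((ln (cabs a))%:E + \sum_(b <- s) (- logkernel (plane b, z)))%E.
Proof.
move=> a0; rewrite -mul_polyC logabs_polyM; congr (_ + _)%E.
  by rewrite /logabs_poly hornerC cabs_eq0 (negbTE a0).
elim: s => [|b s IH]; last by rewrite !big_cons logabs_polyM IH logabs_polyXsubC.
by rewrite !big_nil /logabs_poly hornerC cabs1 oner_eq0 ln1.
Qed.

End PolynomialCoefficients.

(** Each linear factor has an integrable logarithm, so the integral splits and is finite, and the
    default branches of [mahler] are not taken. *)
Lemma mahler_factored {R : realType} (K : set (R * R)) (mu : probability (R * R)%type R)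
    (V : R) (a : R[i]) (s : seq R[i]) :
  compact K -> prob_on K mu -> log_energy mu = V%:E ->
  (forall nu, prob_on K nu -> (V%:E <= log_energy nu)%E) -> a != 0 ->
  mahler mu (a *: \prod_(b <- s) ('X - b%:P)) =
  cabs a * \prod_(b <- s) expR (lpot mu (plane b)).
Proof.
move=> cK muK muV Vmin a0.
have il w := integrable_logkernel K mu V cK muK muV Vmin w.
have lE w := lpotE K mu V cK muK muV Vmin w.
have P0 : a *: \prod_(b <- s) ('X - b%:P) != 0.
  by rewrite scaler_eq0 negb_or a0/= monic_neq0// monic_prod_XsubC.
rewrite /mahler (negbTE P0).
have -> : (\int[mu]_p logabs_poly (a *: \prod_(b <- s) ('X - b%:P)) p =
    (ln (cabs a) + \sum_(b <- s) lpot mu (plane b))%:E)%E.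
  under eq_integral do rewrite logabs_poly_factored//.
  rewrite integralD//; last first.
  - by apply: integrable_sum => // b _; exact: il.
  - exact: finite_measure_integrable_cst.
  rewrite integral_cst// [X in (_ * X)%E](_ : _ = 1%E); last exact: probability_setT.
  rewrite mule1 EFinD; congr (_ + _)%E.
  by rewrite integral_sum// -sumEFin; apply: eq_bigr => b _; exact: lE.
by rewrite expRD lnK ?posrE ?lt_neqAle 1?eq_sym ?cabs_eq0 ?a0 ?cabs_ge0// expR_sum.
Qed.


(** * The coefficient bound *)

Theorem theorem5p1 (R : realType) (K : set (R * R))
    (mu : probability (R * R)%type R) (d : nat) (P : {poly R[i]}) :
  compact K -> non_polar K -> equilibrium_measure K mu ->
  (size P <= d.+1)%N ->
  forall k : nat, (k <= d)%N ->
    cabs P`_k <=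
      ('C(d, k))%:R * mahler mu P * maxmod K ^+ (d - k) / log_cap K ^+ d.
Proof.
move=> cK npK [muK muR] sP k kd.
have [V rV capV] := log_cap_gt0 K npK.
have muV : log_energy mu = V%:E by rewrite muR.
have Vmin nu : prob_on K nu -> (V%:E <= log_energy nu)%E.
  by move=> nuK; rewrite -rV; apply: ereal_inf_lbound; exists nu.
have Kr z : K z -> cabs (cpt z) <= maxmod K by exact: maxmod_ge.
have ge_cap := log_cap_le_radius K mu V cK muK muV Vmin.
have V0 := expR_gt0 (- V).
(* [log_cap_le_radius] asks for a positive radius, not yet known for [maxmod K]. If the claim
   failed, the maximum with half the capacity would be an admissible radius below the capacity. *)
have capr : expR (- V) <= maxmod K.
  rewrite leNgt; apply/negP => rcap.
  have := ge_cap (Num.max (maxmod K) (expR (- V) / 2)).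
  rewrite lt_max divr_gt0 ?orbT// le_max leNgt rcap/= => /(_ isT).
  have h : (expR (- V) <= expR (- V) / 2) = false by apply/negbTE; rewrite -ltNge; lra.
  rewrite h => bad; suff : false by [].
  by apply: bad => z /Kr zr; rewrite le_max zr.
have r0 : 0 < maxmod K by exact: lt_le_trans capr.
rewrite capV; set r := maxmod K in Kr capr r0 *; set cap := expR (- V) in V0 capr *.
have [->|P0] := eqVneq P 0; first by rewrite coef0 cabs0 /mahler eqxx mulr0 !mul0r.
have [s Ps] := closed_field_poly_normal P.
have a0 : lead_coef P != 0 by rewrite lead_coef_eq0.
set a := lead_coef P in Ps a0.
have sz : (size s <= d)%N.
  by move: sP; rewrite Ps size_scale// size_prod_XsubC ltnS.
have MP : mahler mu P = cabs a * \prod_(b <- s) expR (lpot mu (plane b)).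
  by rewrite Ps; exact: (mahler_factored K mu V).
(* Frostman's bound serves roots in the disc of radius r, its reflected form those outside. *)
have root_le b : cap * Num.max 1 (cabs b / r) <= expR (lpot mu (plane b)).
  have [br|rb] := leP (cabs b) r.
    rewrite max_l ?ler_pdivrMr ?mul1r// mulr1 ler_expR.
    exact: (lpot_ge K mu V).
  rewrite max_r ?ler_pdivlMr ?mul1r ?(ltW rb)//.
  have q0 : 0 < cabs b / r by rewrite divr_gt0// (lt_trans r0).
  rewrite mulrC -[cabs b / r]lnK ?posrE// -expRD ler_expR.
  have := lpot_ge_reflect K mu V cK muK muV Vmin (plane b) r r0 Kr.
  by rewrite planeK; apply; exact: ltW.
have maxs : cap ^+ size s * \prod_(b <- s) Num.max 1 (cabs b / r) <=
    \prod_(b <- s) expR (lpot mu (plane b)).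
  have -> : cap ^+ size s = \prod_(b <- s) cap.
    by rewrite big_const_seq count_predT -Monoid.iteropE.
  rewrite -big_split/=; apply: ler_prod => b _; rewrite root_le andbT.
  by rewrite mulr_ge0 ?(ltW V0)// le_max ler01.
rewrite {1}Ps coefZ cabsM.
have coef := cabs_prodXsub_coef s r k r0.
have M0 : 0 <= mahler mu P.
  by rewrite MP mulr_ge0 ?cabs_ge0// prodr_ge0// => b _; exact: expR_ge0.
(* Here [size s] is the degree of [P]; above it the coefficient is 0 and the right-hand side is
   nonnegative. *)
have [ks|ks] := leqP k (size s); last first.
  have -> : cabs (\prod_(z <- s) ('X - z%:P))`_k = 0.
    apply/eqP; rewrite eq_le cabs_ge0 andbT.
    by rewrite (le_trans coef)// bin_small// !mul0r.
  rewrite mulr0 divr_ge0 ?exprn_ge0 ?(ltW V0)//.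
  by rewrite !mulr_ge0 ?exprn_ge0 ?(ltW r0).
set Pi := \prod_(b <- s) Num.max _ _ in maxs coef.
have step1 : cabs a * cabs (\prod_(z <- s) ('X - z%:P))`_k <=
    'C(size s, k)%:R * mahler mu P * r ^+ (size s - k) / cap ^+ size s.
  rewrite ler_pdivlMr ?exprn_gt0// MP.
  have -> : 'C(size s, k)%:R * (cabs a * \prod_(b <- s) expR (lpot mu (plane b))) *
      r ^+ (size s - k) = cabs a * ('C(size s, k)%:R * r ^+ (size s - k) *
        \prod_(b <- s) expR (lpot mu (plane b))) by ring.
  rewrite -[leLHS]mulrA ler_wpM2l ?cabs_ge0//.
  apply: (@le_trans _ _ ('C(size s, k)%:R * r ^+ (size s - k) * Pi * cap ^+ size s)).
    by rewrite ler_wpM2r ?exprn_ge0 ?(ltW V0).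
  rewrite -[leLHS]mulrA ler_wpM2l ?mulr_ge0 ?exprn_ge0 ?(ltW r0)//.
  by rewrite mulrC.
apply: (le_trans step1).
have dk : (d - k = (size s - k) + (d - size s))%N by rewrite addnC addnBA// subnK.
(* Passing from the degree to d multiplies the bound by a power of r/cap >= 1 and does not decrease
   the binomial. *)
have ratio : r ^+ (d - k) / cap ^+ d =
    r ^+ (size s - k) / cap ^+ size s * (r / cap) ^+ (d - size s).
  by rewrite expr_div_n mulf_div -!exprD -dk subnKC.
rewrite -[leRHS]mulrA ratio -[leLHS]mulrA.
have X0 : 0 <= r ^+ (size s - k) / cap ^+ size s.
  by rewrite divr_ge0// exprn_ge0// ltW.
apply: ler_pM => //; first exact: mulr_ge0.
  by rewrite ler_wpM2r// ler_nat leq_bin2l.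
by rewrite ler_peMr// exprn_ege1// ler_pdivlMr// mul1r.
Qed.
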